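(* Assume $s=d$. Let $R^*$ have the distribution of $R$, independent of $X^{(n)}$, and for $\alpha\ge0$ define $$D^{\prime,(\alpha)}_{\mathsf{out},n}=\sum_{(\xi,r)\in X^{(n)}}|\xi|^\alpha 1\{((o,R^* ),(\xi,r))\text{ is an edge in }G^\prime(\{(o,R^* )\}\cup X^{(n)})\},$$ where $|\xi|={\rm d}_{\mathbb{T}_n}(\xi,o)$. Then $\mathbb{E}D^{\prime,(0)}_{\mathsf{out},n}\in O(1)$ as $n\to\infty$, and if $\alpha>0$ there exists $\delta>0$ such that $\mathbb{E}D^{\prime,(\alpha)}_{\mathsf{out},n}\in O(n^{\alpha-\delta})$.
   Context: Fix an integer $d\ge2$. For $n\ge1$, $\mathbb{T}_n$ is the torus obtained from $[-n/2,n/2]^d$ by identifying opposite faces, with toroidal distance ${\rm d}_{\mathbb{T}_n}$ and $B^{\mathbb{T}_n}_r(\xi)=\{\eta\in\mathbb{T}_n:{\rm d}_{\mathbb{T}_n}(\xi,\eta)\le r\}$. $R$ is a nonnegative random variable with absolutely continuous distribution such that $\lim_{h\to\infty}h^s\mathbb{P}(R>h)=\beta$ for some $\beta,s\in(0,\infty)$. $X^{(n)}$ is a homogeneous Poisson point process of intensity $1$ on $\mathbb{T}_n$, each point independently marked with a mark in $[0,\infty)$ distributed as $R$ (points written $(\xi,r)$). For a finite set $\varphi\subset\mathbb{T}_n\times[0,\infty)$, the thinned scale-free Gilbert graph $G^\prime(\varphi)$ has vertex set $\varphi$ and a directed edge from $(\xi,r)\in\varphi$ to $(\eta,t)\in\varphi$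 iff $(\eta,t)\in B^{\mathbb{T}_n}_r(\xi)\times[0,r)$ and there is no $(\zeta,w)\in\varphi\cap(B^{\mathbb{T}_n}_r(\xi)\times(t,r))$ with $\eta\in B^{\mathbb{T}_n}_w(\zeta)$. *)

(* Defs.v *)
From HB Require Import structures.
From mathcomp Require Import all_boot all_order all_algebra.
From mathcomp Require Import all_classical all_reals all_analysis.
Set Implicit Arguments. Unset Strict Implicit. Unset Printing Implicit Defensive.
Import Order.TTheory GRing.Theory Num.Theory.
Import numFieldNormedType.Exports.
Local Open Scope classical_set_scope.
Local Open Scope ring_scope.

Section ScaleFreeGilbert.
Variable R : realType.

(* A point of the torus T_n is represented by its coordinate list (length d)
   in the fundamental box [-n/2, n/2]^d; a marked point is (xi, r). *)
Definition mpoint := (seq R * R)%type.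

(* distance on the circle R/nZ between two coordinates of the box *)
Definition circ (n : R) (t : R) : R := Num.min `|t| (n - `|t|).

Definition tdist (n : R) (x y : seq R) : R :=
  Num.sqrt (\sum_(p <- zip x y) (circ n (p.1 - p.2)) ^+ 2).

Definition inball (n : R) (xi : seq R) (r : R) (eta : seq R) : bool :=
  tdist n xi eta <= r.

Definition edge (n : R) (phi : seq mpoint) (a b : mpoint) : bool :=
  [&& inball n a.1 a.2 b.1, 0 <= b.2, b.2 < a.2 &
   ~~ has (fun c : mpoint => [&& inball n a.1 a.2 c.1, b.2 < c.2, c.2 < a.2 &
                                 inball n c.1 c.2 b.1]) phi].

Definition origin (d : nat) : seq R := nseq d 0.

Definition Dout (d : nat) (n : R) (alpha : R) (rs : R) (X : seq mpoint) : R :=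
  \sum_(p <- X) (tdist n p.1 (origin d) `^ alpha) *
     (edge n ((origin d, rs) :: X) (origin d, rs) p)%:R.

Local Open Scope ereal_scope.

Fixpoint boxint (n : R) (m : nat) (F : seq R -> \bar R) : \bar R :=
  match m with
  | 0%N => F [::]
  | m'.+1 => \int[@lebesgue_measure R]_(x in `[(- n / 2)%R, (n / 2)%R])
               boxint n m' (fun s => F (x :: s))
  end.

Definition ptint (d : nat) (n : R) (PR : probability R R) (G : mpoint -> \bar R)
  : \bar R :=
  \int[PR]_(r in [set: R]) boxint n d (fun xi => G (xi, r)).

Fixpoint cfgint (d : nat) (n : R) (PR : probability R R) (k : nat)
    (F : seq mpoint -> \bar R) : \bar R :=
  match k with
  | 0%N => F [::]
  | k'.+1 => ptint d n PR (fun p => cfgint d n PR k' (fun s => F (p :: s)))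
  end.

(* expectation of a nonnegative functional of the marked Poisson process
   X^{(n)} of intensity 1 on T_n with i.i.d. marks of law PR:
   E F(X) = sum_k e^{-n^d}/k! \int F(x_1,..,x_k) Lambda(dx_1)...Lambda(dx_k) *)
Definition poisson_expect (d : nat) (n : R) (PR : probability R R)
    (F : seq mpoint -> \bar R) : \bar R :=
  \sum_(0 <= k <oo) ((expR (- (n ^+ d)) / (k`!)%:R)%:E * cfgint d n PR k F).

Definition EDout (d : nat) (n : nat) (PR : probability R R) (alpha : R) : \bar R :=
  \int[PR]_(rs in [set: R])
     poisson_expect d n%:R PR (fun X => (Dout d n%:R alpha rs X)%:E).

End ScaleFreeGilbert.

(* Main.v *)
Require Import Defs.
From HB Require Import structures.
From mathcomp Require Import all_boot all_order all_algebra.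
From mathcomp Require Import all_classical all_reals all_analysis.
From mathcomp Require Import measurable_realfun ring lra zify.
Set Implicit Arguments. Unset Strict Implicit. Unset Printing Implicit Defensive.
Import Order.TTheory GRing.Theory Num.Theory.
Import numFieldNormedType.Exports HBNNSimple.
Local Open Scope classical_set_scope.
Local Open Scope ring_scope.

(* Cut marks into dyadic levels h_i = h0 2^i up to the scale of n and space into
   unit cells. An edge from the origin, of mark r > h_(k-1), to a point of a given
   cell with mark at most h_j forces the process to avoid, for every level i with
   j <= i < k - 1, all points with mark in ]h_i, h_(i+1)] in a box of side of
   order h_i shifted from the cell towards the origin: such a point would lie in
   the ball of the origin and reach the whole cell. As P(R > h) ~ beta h^-d, each
   of these boxes has intensity measure at least a constant c independent of i, so
   by the Mecke formula the edge survives with probability at most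
   exp(-c (k - 1 - j)). Summing over the O(h_k^d) cells and over j and k, against
   the tails P(R > h_j) = O(2^(-d j)), bounds the expectation by a constant times
   the sum of the (2^(alpha - delta))^k over 2^k <= O(n), for every small delta > 0.

   Everything is dominated by finite sums of products of one-point functions, whose
   iterated integrals factorise, so no Fubini theorem is used. *)

(** * Iterated integrals *)

(* No measurability is needed: the integral of a nonnegative function is a
   supremum over the simple functions below it. *)
Lemma ge0_le_integral_nomeas dsp (T : measurableType dsp) (R : realType)
    (mu : {measure set T -> \bar R}) (D : set T) (f g : T -> \bar R) :
  (forall x, D x -> 0 <= f x)%E -> (forall x, D x -> f x <= g x)%E ->
  (\int[mu]_(x in D) f x <= \int[mu]_(x in D) g x)%E.
Proof.
move=> f0 fg; have g0 x : D x -> (0 <= g x)%E.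
  by move=> Dx; exact: le_trans (f0 _ Dx) (fg _ Dx).
rewrite !ge0_integralE//; apply: ereal_sup_le => _ [h /= hf <-].
exists h => //= x.
apply: le_trans (hf x) _; rewrite /patch; case: ifPn => // /set_mem; exact: fg.
Qed.

Section IteratedIntegrals.
Variable R : realType.

Definition has_integral dsp (T : measurableType dsp)
    (mu : {measure set T -> \bar R}) (D : set T) (V : T -> R) (v : R) : Prop :=
  mu.-integrable D (EFin \o V) /\ (\int[mu]_(x in D) (V x)%:E = v%:E)%E.

Lemma has_integral_lin dsp (T : measurableType dsp)
    (mu : {measure set T -> \bar R}) (D : set T) (U V : T -> R) (a b u v : R) :
  measurable D -> has_integral mu D U u -> has_integral mu D V v ->
  has_integral mu D (fun x => a * U x + b * V x) (a * u + b * v).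
Proof.
move=> mD [iU eU] [iV eV].
have iaU := integrableZl mD a iU; have ibV := integrableZl mD b iV.
split; first exact: (integrableD mD iaU ibV).
under eq_integral do rewrite EFinD !EFinM.
by rewrite integralD//= !integralZl// eU eV.
Qed.

Lemma has_integral_indic dsp (T : measurableType dsp)
    (mu : {measure set T -> \bar R}) (D A : set T) :
  measurable D -> measurable A -> (mu D < +oo)%E ->
  has_integral mu D (\1_A) (fine (mu (A `&` D))).
Proof.
move=> mD mA Doo.
have fA : (mu (A `&` D) < +oo)%E.
  by apply: le_lt_trans Doo; rewrite le_measure ?inE//; exact: measurableI.
split; last first.
  by rewrite integral_indic// fineK// ge0_fin_numE.
apply/integrableP; split; first by apply/measurable_EFinP; exact: measurable_indic.
under eq_integral do rewrite /= indicE normr_nat -indicE.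
by rewrite integral_indic.
Qed.

Lemma has_integral_ext dsp (T : measurableType dsp)
    (mu : {measure set T -> \bar R}) (D : set T) (U V : T -> R) (v : R) :
  U =1 V -> has_integral mu D U v -> has_integral mu D V v.
Proof. by move=> /funext ->. Qed.

(* The relations [boxI], [ptI], [cfgI] say that the iterated integrals [boxint],
   [ptint], [cfgint] of a real function have integrable integrands at every
   stage, and value [v]; this is what makes them linear. *)
Fixpoint boxI (n : R) (m : nat) (F : seq R -> R) (v : R) : Prop :=
  match m with
  | 0%N => F [::] = v
  | m'.+1 => exists2 V : R -> R,
      (forall x, boxI n m' (fun s => F (x :: s)) (V x)) &
      has_integral lebesgue_measure `[(- n / 2)%R, (n / 2)%R] V v
  end.

Definition ptI (d : nat) (n : R) (PR : probability R R) (F : mpoint R -> R)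
    (v : R) : Prop :=
  exists2 V : R -> R, (forall r, boxI n d (fun xi => F (xi, r)) (V r)) &
     has_integral PR setT V v.

Fixpoint cfgI (d : nat) (n : R) (PR : probability R R) (k : nat)
    (F : seq (mpoint R) -> R) (v : R) : Prop :=
  match k with
  | 0%N => F [::] = v
  | k'.+1 => exists2 V : mpoint R -> R,
      (forall p, cfgI d n PR k' (fun s => F (p :: s)) (V p)) & ptI d n PR V v
  end.

Variables (d : nat) (n : R) (PR : probability R R).

Lemma boxI_lin m F G (a b u v : R) : boxI n m F u -> boxI n m G v ->
  boxI n m (fun s => a * F s + b * G s) (a * u + b * v).
Proof.
elim: m F G u v => [|m IH] F G u v /=; first by move=> -> ->.
move=> [U FU Uu] [V GV Vv]; exists (fun x => a * U x + b * V x).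
  by move=> x; exact: IH.
exact: has_integral_lin.
Qed.

Lemma boxI_boxint m F v : boxI n m F v ->
  boxint n m (fun s => (F s)%:E) = v%:E.
Proof.
elim: m F v => [|m IH] F v /=; first by move=> ->.
move=> [V FV [_ Vv]]; rewrite -Vv; apply: eq_integral => x _; exact: IH.
Qed.

Lemma ptI_lin F G (a b u v : R) : ptI d n PR F u -> ptI d n PR G v ->
  ptI d n PR (fun s => a * F s + b * G s) (a * u + b * v).
Proof.
move=> [U FU Uu] [V GV Vv]; exists (fun x => a * U x + b * V x).
  by move=> r; exact: boxI_lin.
exact: has_integral_lin.
Qed.

Lemma ptI_ptint F v : ptI d n PR F v -> ptint d n PR (fun s => (F s)%:E) = v%:E.
Proof.
move=> [V FV [_ Vv]]; rewrite /ptint -Vv; apply: eq_integral => x _.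
exact: boxI_boxint.
Qed.

Lemma cfgI_lin k F G (a b u v : R) : cfgI d n PR k F u -> cfgI d n PR k G v ->
  cfgI d n PR k (fun s => a * F s + b * G s) (a * u + b * v).
Proof.
elim: k F G u v => [|k IH] F G u v /=; first by move=> -> ->.
move=> [U FU Uu] [V GV Vv]; exists (fun x => a * U x + b * V x).
  by move=> p; exact: IH.
exact: ptI_lin.
Qed.

Lemma cfgI_cfgint k F v : cfgI d n PR k F v ->
  cfgint d n PR k (fun s => (F s)%:E) = v%:E.
Proof.
elim: k F v => [|k IH] F v /=; first by move=> ->.
move=> [V FV /ptI_ptint <-]; congr ptint; apply/funext => p; exact: IH.
Qed.

Lemma has_integral0 dsp (T : measurableType dsp)
    (mu : {measure set T -> \bar R}) (D : set T) :
  measurable D -> has_integral mu D (cst 0) 0.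
Proof. by move=> mD; split; [exact: integrable0|exact: integral0]. Qed.

Lemma boxI0 m : boxI n m (fun=> 0) 0.
Proof. by elim: m => //= m IH; exists (cst 0) => //; exact: has_integral0. Qed.

Lemma ptI0 : ptI d n PR (fun=> 0) 0.
Proof. by exists (cst 0) => [r|]; [exact: boxI0|exact: has_integral0]. Qed.

Lemma cfgI0 k : cfgI d n PR k (fun=> 0) 0.
Proof. by elim: k => //= k IH; exists (fun=> 0) => //; exact: ptI0. Qed.

Lemma ptI_sum (I : Type) (r : seq I) (F : I -> mpoint R -> R) (v : I -> R) :
  (forall i, ptI d n PR (F i) (v i)) ->
  ptI d n PR (fun x => \sum_(i <- r) F i x) (\sum_(i <- r) v i).
Proof.
move=> H; elim: r => [|i r IH].
  rewrite big_nil; under [X in ptI _ _ _ X]eq_fun do rewrite big_nil.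
  exact: ptI0.
rewrite big_cons; under [X in ptI _ _ _ X]eq_fun do rewrite big_cons.
have := ptI_lin 1 1 (H i) IH; rewrite !mul1r.
by under [X in ptI _ _ _ X]eq_fun do rewrite !mul1r.
Qed.

Lemma cfgI_sum k (I : Type) (r : seq I) (F : I -> seq (mpoint R) -> R)
    (v : I -> R) :
  (forall i, cfgI d n PR k (F i) (v i)) ->
  cfgI d n PR k (fun x => \sum_(i <- r) F i x) (\sum_(i <- r) v i).
Proof.
move=> H; elim: r => [|i r IH].
  rewrite big_nil; under [X in cfgI _ _ _ _ X]eq_fun do rewrite big_nil.
  exact: cfgI0.
rewrite big_cons; under [X in cfgI _ _ _ _ X]eq_fun do rewrite big_cons.
have := cfgI_lin 1 1 (H i) IH; rewrite !mul1r.
by under [X in cfgI _ _ _ _ X]eq_fun do rewrite !mul1r.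
Qed.

Lemma cfgI_scale k (a : R) F v : cfgI d n PR k F v ->
  cfgI d n PR k (fun x => a * F x) (a * v).
Proof.
move=> H; have := cfgI_lin a 0 H (cfgI0 k); rewrite mul0r addr0.
by congr (cfgI _ _ _ _ _ _); apply/funext => s; rewrite addr0.
Qed.

Definition in_torus (xi : seq R) : bool :=
  (size xi == d) && all (fun x => - n / 2 <= x <= n / 2) xi.

Lemma boxint_ge0 m (F : seq R -> \bar R) :
  (forall s, 0 <= F s)%E -> (0 <= boxint n m F)%E.
Proof.
elim: m F => [|m IH] F F0 //=; apply: integral_ge0 => x _; exact: IH.
Qed.

Lemma ptint_ge0 (F : mpoint R -> \bar R) :
  (forall s, 0 <= F s)%E -> (0 <= ptint d n PR F)%E.
Proof. by move=> F0; apply: integral_ge0 => r _; exact: boxint_ge0. Qed.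

Lemma cfgint_ge0 k (F : seq (mpoint R) -> \bar R) :
  (forall s, 0 <= F s)%E -> (0 <= cfgint d n PR k F)%E.
Proof. by elim: k F => [|k IH] F F0 //=; apply: ptint_ge0 => p; exact: IH. Qed.

Lemma le_boxint m (F G : seq R -> \bar R) : (forall s, 0 <= F s)%E ->
  (forall s, size s = m -> all (fun x => - n / 2 <= x <= n / 2)%R s ->
     F s <= G s)%E ->
  (boxint n m F <= boxint n m G)%E.
Proof.
elim: m F G => [|m IH] F G F0 FG /=; first exact: FG.
apply: ge0_le_integral_nomeas => x /=; first by move=> _; exact: boxint_ge0.
rewrite in_itv/= => xD; apply: IH => // s ss sD.
by apply: FG; rewrite /= ?ss// xD.
Qed.

Lemma le_ptint (F G : mpoint R -> \bar R) : (forall s, 0 <= F s)%E ->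
  (forall p, in_torus p.1 -> F p <= G p)%E ->
  (ptint d n PR F <= ptint d n PR G)%E.
Proof.
move=> F0 FG; apply: ge0_le_integral_nomeas => r _; first exact: boxint_ge0.
by apply: le_boxint => // s ss sD; apply: FG; rewrite /in_torus ss eqxx.
Qed.

(** The dominated functional [F] may be non-measurable, as its iterated integrals are only compared
    and never computed. [Dout] enters in this way. *)
Lemma le_cfgint k (F G : seq (mpoint R) -> \bar R) : (forall s, 0 <= F s)%E ->
  (forall s, all (fun p => in_torus p.1) s -> F s <= G s)%E ->
  (cfgint d n PR k F <= cfgint d n PR k G)%E.
Proof.
elim: k F G => [|k IH] F G F0 FG /=; first exact: FG.
apply: le_ptint => [p|p pD]; first exact: cfgint_ge0.
by apply: IH => // s sD; apply: FG; rewrite /= pD.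
Qed.

Lemma ptI_ge0 F v : (forall p, 0 <= F p) -> ptI d n PR F v -> 0 <= v.
Proof.
by move=> F0 /ptI_ptint Fv; rewrite -lee_fin -Fv ptint_ge0// => p; rewrite lee_fin.
Qed.

(* The Mecke formula is only needed for these functionals: [f] marks a point,
   [g] tests that another point does not block it. *)
Fixpoint mecke_sum (f g : mpoint R -> R) (s : seq (mpoint R)) : R :=
  if s is p :: s' then f p * (\prod_(x <- s') g x) + g p * mecke_sum f g s' else 0.

(** Each of the [k] points in turn carries [f] and contributes [F], while the other [k - 1] points
    contribute [M] each. *)
Lemma cfgI_mecke_sum f g (F M : R) k : ptI d n PR f F -> ptI d n PR g M ->
  cfgI d n PR k (mecke_sum f g) (k%:R * F * M ^+ k.-1).
Proof.
move=> fF gM.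
(* Combinations of [mecke_sum] and the plain product form a family closed under fixing the first
   point [p]: the coefficients become [a * g p] and [a * f p + b * g p]. *)
suff H (a b : R) :
  cfgI d n PR k (fun s => a * mecke_sum f g s + b * \prod_(x <- s) g x)
    (a * (k%:R * F * M ^+ k.-1) + b * M ^+ k).
  have := H 1 0; rewrite mul1r mul0r addr0.
  by congr (cfgI _ _ _ _ _ _); apply/funext => s; rewrite mul1r mul0r addr0.
elim: k a b => [|k IH] a b /=.
  by rewrite big_nil expr0 !mul0r mulr0 !add0r.
exists (fun p => (a * M ^+ k) * f p +
                 (a * (k%:R * F * M ^+ k.-1) + b * M ^+ k) * g p).
  move=> p; have := IH (a * g p) (a * f p + b * g p).
  set V := (X in cfgI _ _ _ _ _ X -> _).
  have -> : V = a * M ^+ k * f p + (a * (k%:R * F * M ^+ k.-1) + b * M ^+ k) * g p.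
    by rewrite /V; ring.
  congr (cfgI _ _ _ _ _ _); apply/funext => s; rewrite big_cons; ring.
have := ptI_lin (a * M ^+ k) (a * (k%:R * F * M ^+ k.-1) + b * M ^+ k) fF gM.
congr (ptI _ _ _ _ _); rewrite -natr1 exprS.
by case: k {IH} => [|k] /=; rewrite ?expr0 ?exprS; ring.
Qed.

End IteratedIntegrals.

(** * Boxes and Poisson expectations *)

Section Boxes.
Variables (R : realType) (d : nat) (n : R) (PR : probability R R).

Definition inbox (B : seq (R * R)) (xi : seq R) : bool :=
  all2 (fun ab x => ab.1 <= x <= ab.2) B xi.

Definition torus_len (ab : R * R) : R :=
  fine (lebesgue_measure (`[ab.1, ab.2] `&` `[(- n / 2)%R, (n / 2)%R])).

Lemma torus_len_ge0 ab : 0 <= torus_len ab.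
Proof. exact: fine_ge0. Qed.

Lemma torus_len_le ab : ab.1 <= ab.2 -> torus_len ab <= ab.2 - ab.1.
Proof.
move=> le12; rewrite /torus_len -lee_fin.
have H : (lebesgue_measure (`[ab.1, ab.2] `&` `[(- n / 2)%R, (n / 2)%R]) <=
          (ab.2 - ab.1)%:E)%E.
  apply: (@le_trans _ _ (lebesgue_measure `[ab.1, ab.2])).
    by rewrite le_measure ?inE//; exact: measurableI.
  by rewrite lebesgue_measure_itv/= lte_fin; case: ltgtP le12 => // -> _;
     rewrite subrr.
rewrite fineK//; rewrite ge0_fin_numE//; exact: le_lt_trans H (ltry _).
Qed.

Lemma torus_lenE (ab : R * R) : ab.1 <= ab.2 -> - n / 2 <= ab.1 -> ab.2 <= n / 2 ->
  torus_len ab = ab.2 - ab.1.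
Proof.
move=> le12 ge1 le2; rewrite /torus_len (_ : _ `&` _ = `[ab.1, ab.2]%classic).
  by rewrite lebesgue_measure_itv/= lte_fin; case: ltgtP le12 => // -> _;
     rewrite subrr.
apply: setIidl => x /=; rewrite !in_itv/= => /andP[xa xb].
by rewrite (le_trans ge1 xa) (le_trans xb le2).
Qed.

Lemma boxI_inbox B :
  boxI n (size B) (fun s => (inbox B s)%:R) (\prod_(ab <- B) torus_len ab).
Proof.
elim: B => [|ab B IH]; first by rewrite big_nil.
set P := \prod_(i <- B) torus_len i in IH.
(* The summand [0 * 0] only matches the shape of [has_integral_lin], so that scaling is linearity
   with the zero function. *)
exists (fun x => P * \1_(`[ab.1, ab.2]%classic) x + 0 * 0) => [x|].
  have := boxI_lin (\1_(`[ab.1, ab.2]%classic) x) 0 IH (boxI0 n (size B)).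
  rewrite (mulrC P); congr (boxI _ _ _ _); apply/funext => s.
  rewrite /= mul0r addr0 indicE mem_setE in_itv /=.
  by case: (_ && _); rewrite /= ?mul1r ?mul0r.
have m0 : measurable (`[(- n / 2)%R, (n / 2)%R] : set R) by [].
rewrite (_ : \prod_(i <- _) _ = P * torus_len ab + 0 * 0); last first.
  by rewrite big_cons mul0r addr0 [RHS]mulrC.
apply: (@has_integral_lin _ _ _ _ _ _ (cst 0)) => //; last exact: has_integral0.
apply: has_integral_indic => //.
by rewrite /= lebesgue_measure_itv/=; case: ifP => // _; exact: ltry.
Qed.

Lemma ptI_inbox B (A : set R) : size B = d -> measurable A ->
  ptI d n PR (fun p => (inbox B p.1)%:R * \1_A p.2)
    ((\prod_(ab <- B) torus_len ab) * fine (PR A)).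
Proof.
move=> <- mA; set P := \prod_(ab <- B) _.
exists (fun x => P * \1_A x + 0 * 0) => [x|].
  have := boxI_lin (\1_A x) 0 (boxI_inbox B) (boxI0 n (size B)).
  rewrite -/P (mulrC P); congr (boxI _ _ _ _); apply/funext => s.
  by rewrite /= mul0r addr0 mulrC.
have mT : measurable (setT : set R) by [].
rewrite (_ : P * fine _ = P * fine (PR A) + 0 * 0); last by rewrite mul0r addr0.
apply: (@has_integral_lin _ _ _ _ _ _ (cst 0)) => //; last exact: has_integral0.
rewrite -[in fine _](setIT A); apply: has_integral_indic => //.
exact: (le_lt_trans (probability_le1 PR mT) (ltry _)).
Qed.

Lemma ptI1 : 0 <= n -> ptI d n PR (fun=> 1) (n ^+ d).
Proof.
move=> n0; exists (cst (n ^+ d)) => [r|].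
  rewrite /=; elim: d => [|m IH] /=; first by rewrite expr0.
  exists (cst (n ^+ m)); first by move=> x; exact: IH.
  have En : fine (lebesgue_measure (`[(- n / 2)%R, (n / 2)%R] `&`
      `[(- n / 2)%R, (n / 2)%R]%classic)) = n.
    have := @torus_lenE (- n / 2, n / 2); rewrite /torus_len /= => ->; lra.
  have [iH eH] : has_integral lebesgue_measure `[(- n / 2)%R, (n / 2)%R]
      (fun x => n ^+ m * \1_(`[(- n / 2)%R, (n / 2)%R]%classic) x + 0 * 0)
      (n ^+ m * n + 0 * 0).
    apply: (@has_integral_lin _ _ _ _ _ _ (cst 0)) => //; last exact: has_integral0.
    rewrite -[X in has_integral _ _ _ X]En; apply: has_integral_indic => //.
    by rewrite /= lebesgue_measure_itv/=; case: ifP => // _; exact: ltry.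
  move: iH eH; rewrite mul0r !addr0 => iH eH.
  rewrite exprSr; split.
    apply: eq_integrable iH => // x xD /=.
    by rewrite indicE xD mulr1 addr0.
  rewrite -eH; apply: eq_integral => x xD /=.
  by rewrite indicE xD mulr1 addr0.
split; first exact: finite_measure_integrable_cst.
rewrite /= integral_cst// -[RHS]mule1; congr (_ * _)%E; exact: probability_setT.
Qed.

End Boxes.

Section PoissonBound.
Variables (R : realType) (d : nat) (n : R) (PR : probability R R).

(** This is the termwise derivative of the exponential series: the term [k = 0] vanishes, and an
    index shift gives back the series itself. *)
Lemma exp_partial_sum_le (M : R) N : 0 <= M ->
  \sum_(0 <= k < N) ((k`!)%:R^-1 * (k%:R * M ^+ k.-1)) <= expR M.
Proof.
move=> M0; case: N => [|N]; first by rewrite big_geq// expR_ge0.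
rewrite big_nat_recl// mul0r mulr0 add0r.
have -> : \sum_(0 <= i < N) ((i.+1)`!%:R^-1 * (i.+1%:R * M ^+ i.+1.-1)) =
          series (exp_coeff M) N.
  apply: eq_bigr => i _; rewrite factS natrM invfM /exp_coeff /=.
  by rewrite mulrACA mulVf ?pnatr_eq0// mul1r mulrC.
apply: nondecreasing_cvgn_le; last exact: is_cvg_series_exp_coeff.
apply: nondecreasing_series => k _ _.
by rewrite /exp_coeff /= divr_ge0// exprn_ge0.
Qed.

(** As [n ^+ d] is the total mass, [n ^+ d - M i] is the integral of [1 - g i]. If [g i] is an
    indicator, the exponential is the probability that no point of the process blocks. *)
Lemma poisson_expect_le (I : Type) (r : seq I) (Fn : seq (mpoint R) -> R)
    (W : R) (f g : I -> mpoint R -> R) (v M : I -> R) :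
  (forall s, 0 <= Fn s) -> 0 <= W ->
  (forall s, all (fun p => in_torus d n p.1) s ->
     Fn s <= W * \sum_(i <- r) mecke_sum (f i) (g i) s) ->
  (forall i, 0 <= v i) -> (forall i, 0 <= M i) ->
  (forall i, ptI d n PR (f i) (v i)) -> (forall i, ptI d n PR (g i) (M i)) ->
  (poisson_expect d n PR (fun X => (Fn X)%:E) <=
    (W * \sum_(i <- r) v i * expR (M i - n ^+ d))%:E)%E.
Proof.
move=> Fn0 W0 FnW v0 M0 fv gM; rewrite /poisson_expect.
set c := fun k : nat => expR (- n ^+ d) / k`!%:R.
have c0 k : 0 <= c k by rewrite divr_ge0// expR_ge0.
have ck k : (cfgint d n PR k (fun X => (Fn X)%:E) <=
    (W * \sum_(i <- r) k%:R * v i * M i ^+ k.-1)%:E)%E.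
  have S i := cfgI_mecke_sum k (fv i) (gM i).
  rewrite -(cfgI_cfgint (cfgI_scale W (cfgI_sum r S))).
  apply: le_cfgint => s; first by rewrite lee_fin.
  by move=> sD; rewrite lee_fin FnW.
apply: lime_le.
  apply: is_cvg_nneseries => k _ _; rewrite mule_ge0 ?lee_fin//.
  by apply: cfgint_ge0 => s; rewrite lee_fin.
apply: nearW => N.
apply: (@le_trans _ _ (\sum_(0 <= k < N)
   (c k * (W * \sum_(i <- r) k%:R * v i * M i ^+ k.-1))%:E)%E).
  by apply: lee_sum => k _; rewrite [leRHS]EFinM lee_wpmul2l// lee_fin.
rewrite sumEFin lee_fin.
under eq_bigr do rewrite mulrCA.
rewrite -mulr_sumr ler_wpM2l//.
under eq_bigr do rewrite mulr_sumr.
rewrite exchange_big/=; apply: ler_sum => i _.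
rewrite expRD [expR (M i) * _]mulrC mulrA.
under eq_bigr => k _.
  rewrite (_ : c k * _ = (v i * expR (- n ^+ d)) *
      (k`!%:R^-1 * (k%:R * M i ^+ k.-1))); last by rewrite /c; ring.
  over.
rewrite -mulr_sumr ler_wpM2l ?exp_partial_sum_le//.
by rewrite mulr_ge0// expR_ge0.
Qed.

End PoissonBound.

(** * Geometry of the torus *)

Section Geometry.
Variable R : realType.
Implicit Types (n t L m x y A : R) (ms xi ze : seq R).

(** For [|t| > n] the value [circ n t] is negative, but it is at least [- |t|] since [n >= 0], so
    the squares still compare. *)
Lemma circ_sqr_le n t : 0 <= n -> circ n t ^+ 2 <= t ^+ 2.
Proof.
move=> n0; rewrite -(real_normK (num_real (circ n t))) -(real_normK (num_real t)).
rewrite lerXn2r ?nnegrE// ler_norml /circ ge_min lexx/= andbT le_min.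
by rewrite (le_trans _ (normr_ge0 t)) ?oppr_le0//= -subr_ge0 opprK subrK.
Qed.

Lemma circ_sqr_small n t : `|t| <= n / 2 -> circ n t ^+ 2 = t ^+ 2.
Proof.
move=> tn; rewrite /circ; have -> : Num.min `|t| (n - `|t|) = `|t|.
  by apply/min_idPl; lra.
by rewrite real_normK// num_real.
Qed.

Lemma circN n t : circ n (- t) = circ n t.
Proof. by rewrite /circ normrN. Qed.

Lemma tdist_origin d n xi : in_torus d n xi ->
  tdist n xi (origin R d) = Num.sqrt (\sum_(x <- xi) x ^+ 2).
Proof.
rewrite /in_torus /tdist => /andP[/eqP <- D]; congr Num.sqrt.
elim: xi D => [|x xi IH] /=; first by rewrite !big_nil.
move=> /andP[xn /IH IHx]; rewrite !big_cons IHx /= subr0 circ_sqr_small//.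
rewrite ler_norml; lra.
Qed.

Lemma tdist_originl d n xi : in_torus d n xi ->
  tdist n (origin R d) xi = Num.sqrt (\sum_(x <- xi) x ^+ 2).
Proof.
rewrite /in_torus /tdist => /andP[/eqP <- D]; congr Num.sqrt.
elim: xi D => [|x xi IH] /=; first by rewrite !big_nil.
move=> /andP[xn /IH IHx]; rewrite !big_cons IHx /= sub0r circN circ_sqr_small//.
rewrite ler_norml; lra.
Qed.

(* The interval [m, m + 1] moved by roughly [L] towards, and possibly past,
   the origin, and stretched to length [L]. *)
Definition inward L m : R * R :=
  if 0 <= m then (m - 2 * L, m - L) else (m + 1 + L, m + 1 + 2 * L).

(** Such an interval lies on one side of the origin, so moving all of it inward has a well-defined
    direction. *)
Definition off_zero m : bool := (0 <= m) || (m + 1 <= 0).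

Definition unit_itv m : R * R := (m, m + 1).


Lemma sqr_le_sqr x y : - x <= y -> y <= x -> y ^+ 2 <= x ^+ 2.
Proof. by move=> h1 h2; rewrite !expr2; nra. Qed.

Lemma sqr_le_sqrN x y : x <= y -> y <= - x -> y ^+ 2 <= x ^+ 2.
Proof. by move=> h1 h2; rewrite -[x ^+ 2]sqrrN; apply: sqr_le_sqr; lra. Qed.

Lemma sqrt_le_abs x t : 0 <= t -> (Num.sqrt x <= t) = (x <= t ^+ 2).
Proof.
by move=> t0; rewrite -{1}(ger0_norm t0) -sqrtr_sqr ler_sqrt// sqr_ge0.
Qed.

Lemma inward_dist1 L m x y : 1 <= L -> off_zero m -> m <= x <= m + 1 ->
  (inward L m).1 <= y <= (inward L m).2 -> (y - x) ^+ 2 <= (3 * L) ^+ 2.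
Proof.
move=> L1 _ mx ym; move: ym; rewrite /inward; case: ifP => /= _ ym;
  by apply: sqr_le_sqr; lra.
Qed.

(** Either [y] stays on the side of [x] and is no farther from the origin, or it has crossed the
    origin by at most [2 * L]. *)
Lemma inward_sqr_le L m x y : 1 <= L -> off_zero m -> m <= x <= m + 1 ->
  (inward L m).1 <= y <= (inward L m).2 -> y ^+ 2 <= x ^+ 2 + 4 * L ^+ 2.
Proof.
move=> L1 om mx ym.
suff [yx|xy] : y ^+ 2 <= x ^+ 2 \/ y ^+ 2 <= (2 * L) ^+ 2.
- by have := sqr_ge0 L; lra.
- by have := sqr_ge0 x; move: xy; rewrite exprMn; lra.
move: om ym; rewrite /off_zero /inward; case: ifP => /= m0 om ym.
  have [y0|y0] := leP 0 y; first by left; apply: sqr_le_sqr; lra.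
  by right; apply: sqr_le_sqr; lra.
have [y0|y0] := leP y 0; first by left; apply: sqr_le_sqrN; lra.
by right; apply: sqr_le_sqr; lra.
Qed.

(** Here [3 <= A] prevents [y] from crossing the origin, so [|y| <= |x| - L], and the cross term
    [2 * |x| * L] of the square gives the gain. *)
Lemma inward_sqr_big L m x y A : 1 <= L -> off_zero m -> m <= x <= m + 1 ->
  (inward L m).1 <= y <= (inward L m).2 -> 3 <= A -> A * L <= `|x| ->
  y ^+ 2 <= x ^+ 2 - (2 * A - 1) * L ^+ 2.
Proof.
move=> L1 om mx ym A3 xA.
have A3L : 3 * L <= A * L by rewrite ler_wpM2r//; lra.
have H : y ^+ 2 <= (`|x| - L) ^+ 2.
  move: om ym xA; rewrite /off_zero /inward; case: ifP => /= m0 om ym.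
    rewrite ger0_norm; last by lra.
    by move=> xA; apply: sqr_le_sqr; lra.
  rewrite ler0_norm; last by lra.
  by move=> xA; apply: sqr_le_sqr; lra.
apply: le_trans H _; rewrite -[x ^+ 2]real_normK ?num_real//.
have : (A * L) * L <= `|x| * L by rewrite ler_wpM2r//; lra.
rewrite !expr2; lra.
Qed.

Lemma inward_sqr_small L m x y A : 1 <= L -> off_zero m -> m <= x <= m + 1 ->
  (inward L m).1 <= y <= (inward L m).2 -> `|x| < A * L ->
  y ^+ 2 <= ((A + 3) * L) ^+ 2.
Proof.
move=> L1 om mx ym; rewrite ltr_norml => xA.
move: ym; rewrite /inward; case: ifP => /= _ ym; apply: sqr_le_sqr; lra.
Qed.

(** The shifted interval is not clipped by the fundamental interval, even when the cell itself
    sticks out by up to one unit. *)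
Lemma inward_itv L m n : off_zero m -> 1 <= L -> 2 * L <= n / 2 ->
  - n / 2 - 1 <= m <= n / 2 ->
  [/\ (inward L m).1 <= (inward L m).2, - n / 2 <= (inward L m).1,
      (inward L m).2 <= n / 2 & (inward L m).2 - (inward L m).1 = L].
Proof.
by rewrite /off_zero /inward; case: ifP => /= m0 om L1 Ln mn; split; lra.
Qed.

Lemma inward_dist n L ms xi ze : 0 <= n -> 1 <= L -> all off_zero ms ->
  inbox (map unit_itv ms) xi -> inbox (map (inward L) ms) ze ->
  \sum_(p <- zip ze xi) circ n (p.1 - p.2) ^+ 2 <= (size ms)%:R * (3 * L) ^+ 2.
Proof.
move=> n0 L1; elim: ms xi ze => [|m ms IH] [|x xi] [|y ze]//=.
  by rewrite big_nil mul0r.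
move=> /andP[om oms] /andP[mx msx] /andP[my msy].
rewrite big_cons /= -natr1 mulrDl mul1r addrC lerD ?IH//.
exact: le_trans (circ_sqr_le _ n0) (inward_dist1 L1 om mx my).
Qed.

Lemma inward_norm_weak L ms xi ze : 1 <= L -> all off_zero ms ->
  inbox (map unit_itv ms) xi -> inbox (map (inward L) ms) ze ->
  \sum_(y <- ze) y ^+ 2 <= \sum_(x <- xi) x ^+ 2 + (size ms)%:R * (4 * L ^+ 2).
Proof.
move=> L1; elim: ms xi ze => [|m ms IH] [|x xi] [|y ze]//=.
  by rewrite !big_nil mul0r addr0.
move=> /andP[om oms] /andP[mx msx] /andP[my msy].
rewrite !big_cons /= -natr1 mulrDl mul1r.
have := inward_sqr_le L1 om mx my; have := IH _ _ oms msx msy; lra.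
Qed.

Lemma inward_norm_big L ms xi ze A : 1 <= L -> all off_zero ms ->
  inbox (map unit_itv ms) xi -> inbox (map (inward L) ms) ze ->
  3 <= A -> has (fun x => A * L <= `|x|) xi ->
  \sum_(y <- ze) y ^+ 2 <= \sum_(x <- xi) x ^+ 2 + (size ms)%:R * (4 * L ^+ 2)
    - (2 * A - 1) * L ^+ 2.
Proof.
move=> L1; elim: ms xi ze => [|m ms IH] [|x xi] [|y ze]//=.
move=> /andP[om oms] /andP[mx msx] /andP[my msy] A3.
rewrite !big_cons /= -natr1 mulrDl mul1r => /orP[xA|hA].
  have := inward_sqr_big L1 om mx my A3 xA.
  have := inward_norm_weak L1 oms msx msy; have := sqr_ge0 L; lra.
have := inward_sqr_le L1 om mx my.
have := IH _ _ oms msx msy A3 hA; lra.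
Qed.

Lemma inward_norm_small L ms xi ze A : 1 <= L -> all off_zero ms ->
  inbox (map unit_itv ms) xi -> inbox (map (inward L) ms) ze ->
  ~~ has (fun x => A * L <= `|x|) xi ->
  \sum_(y <- ze) y ^+ 2 <= (size ms)%:R * ((A + 3) * L) ^+ 2.
Proof.
move=> L1; elim: ms xi ze => [|m ms IH] [|x xi] [|y ze]//=.
  by rewrite !big_nil mul0r.
move=> /andP[om oms] /andP[mx msx] /andP[my msy].
rewrite !big_cons /= -natr1 mulrDl mul1r negb_or -ltNge => /andP[xA hA].
rewrite addrC lerD ?(IH xi)//; exact: inward_sqr_small mx my xA.
Qed.

(* If some coordinate of [xi] is at least [(2 d + 1) L], pulling it in by [L]
   outweighs what the other coordinates may gain; otherwise [ze] is
   within distance [h] of the origin anyway. *)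
Lemma inward_norm L ms xi ze t : 1 <= L -> all off_zero ms ->
  inbox (map unit_itv ms) xi -> inbox (map (inward L) ms) ze ->
  (size ms * (2 * size ms + 4))%:R * L <= t ->
  Num.sqrt (\sum_(x <- xi) x ^+ 2) <= t ->
  Num.sqrt (\sum_(y <- ze) y ^+ 2) <= t.
Proof.
case: ms => [|m ms'].
  by case: xi => // _ _ _; case: ze.
set ms := m :: ms'.
move=> L1 oms msx msy Lt; set e : R := (size ms)%:R.
have e1 : 1 <= e by rewrite /e ler1n.
have t0 : 0 <= t by apply: le_trans Lt; rewrite mulr_ge0//; lra.
rewrite !sqrt_le_abs// => xt.
(* With [A = 2 * e + 1], the loss [(2 * A - 1) * L ^+ 2] in the large coordinate exceeds the gain of
   at most [4 * e * L ^+ 2] over all coordinates. *)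
have [hb|hs] := boolP (has (fun x => (2 * e + 1) * L <= `|x|) xi).
  apply: le_trans (inward_norm_big L1 oms msx msy _ hb) _; first by lra.
  have := sqr_ge0 L; rewrite -/e; nra.
apply: le_trans (inward_norm_small L1 oms msx msy hs) _; rewrite -/e.
have Lt' : e * (2 * e + 4) * L <= t.
  by move: Lt; rewrite natrM natrD natrM -/e.
have : (e * (2 * e + 4) * L) ^+ 2 <= t ^+ 2.
  by rewrite lerXn2r ?nnegrE//; rewrite mulr_ge0//; nra.
apply: le_trans; rewrite (_ : 2 * e + 1 + 3 = 2 * e + 4); last by ring.
rewrite -mulrA [leRHS]exprMn ler_wpM2r ?sqr_ge0//; nra.
Qed.

(** The distance is at most [3 * L] times the square root of the dimension, so a shifted point with
    mark at least [t] reaches the whole cell. *)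
Lemma inward_tdist n L ms xi ze t : 0 <= n -> 1 <= L -> all off_zero ms ->
  inbox (map unit_itv ms) xi -> inbox (map (inward L) ms) ze ->
  (size ms * (2 * size ms + 4))%:R * L <= t -> tdist n ze xi <= t.
Proof.
move=> n0 L1 oms msx msy Lt; set e : R := (size ms)%:R.
have t0 : 0 <= t by apply: le_trans Lt; rewrite mulr_ge0//; lra.
rewrite /tdist sqrt_le_abs//.
apply: le_trans (inward_dist n0 L1 oms msx msy) _.
have Lt' : e * (2 * e + 4) * L <= t.
  by move: Lt; rewrite natrM natrD natrM -/e.
have e0 : 0 <= e by rewrite /e.
have : (e * (2 * e + 4) * L) ^+ 2 <= t ^+ 2.
  by rewrite lerXn2r ?nnegrE//; rewrite mulr_ge0//; nra.
apply: le_trans; rewrite -/e !exprMn mulrA ler_wpM2r ?sqr_ge0//.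
have : e = 0 \/ 1 <= e.
  by rewrite /e; case: (size ms) => [|k]; [left|right; rewrite ler1n].
case=> [->|e1]; first by rewrite !mul0r expr0n mul0r.
by rewrite !expr2; nra.
Qed.

End Geometry.

(** * Covering by cells and blockers *)

Section Covering.
Variable R : realType.

Lemma mecke_sum_ge0 (f g : mpoint R -> R) s : (forall p, 0 <= f p) ->
  (forall p, 0 <= g p) -> 0 <= mecke_sum f g s.
Proof.
move=> f0 g0; elim: s => //= p s IH.
by rewrite addr_ge0// mulr_ge0// prodr_ge0.
Qed.

Lemma mecke_sum_ge (f g : mpoint R -> R) s : (forall p, 0 <= f p) ->
  (forall p, 0 <= g p) ->
  (\sum_(p <- s) f p) * (all (fun x => g x == 1) s)%:R <= mecke_sum f g s.
Proof.
move=> f0 g0; case: (boolP (all _ _)); last first.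
  by rewrite mulr0 mecke_sum_ge0.
rewrite mulr1; elim: s => [|p s IH] /=; first by rewrite big_nil.
rewrite big_cons => /andP[/eqP -> sg]; rewrite mul1r lerD ?IH//.
rewrite big_seq big1 ?mulr1// => x xs; exact/eqP/(allP sg).
Qed.

(** The unit cells of [[-H, H]^d] are indexed by a finite type. Their corners are integral, so
    [off_zero] holds in each coordinate. *)
Definition cell_corner d (H : nat) (c : d.-tuple 'I_(H.*2)) : seq R :=
  [seq (nat_of_ord i)%:R - H%:R | i <- c].

Lemma size_cell_corner d H (c : d.-tuple 'I_(H.*2)) : size (cell_corner c) = d.
Proof. by rewrite size_map size_tuple. Qed.

Lemma cell_corner_off_zero d H (c : d.-tuple 'I_(H.*2)) :
  all (@off_zero R) (cell_corner c).
Proof.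
rewrite all_map; apply/allP => i _ /=; rewrite /off_zero subr_ge0 ler_nat.
by case: leqP => //= iH; rewrite addrAC natr1 subr_le0 ler_nat.
Qed.

Lemma cell_corner_bounds d H (c : d.-tuple 'I_(H.*2)) x : x \in cell_corner c ->
  - H%:R <= x <= H%:R - 1.
Proof.
case/mapP => i _ ->.
have : (i.+1 <= H + H)%N by rewrite addnn; exact: ltn_ord.
rewrite -(ler_nat R) natrD -natr1 => iH'.
by have : 0 <= (i : nat)%:R :> R by []; lra.
Qed.

Lemma cell_cover d (H : nat) xi : size xi = d -> (0 < H)%N ->
  all (fun x : R => `|x| <= H%:R) xi ->
  exists c : d.-tuple 'I_(H.*2), inbox (map (@unit_itv R) (cell_corner c)) xi.
Proof.
move=> <- H0; elim: xi => [|x xi IH] /=; first by move=> _; exists [tuple].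
move=> /andP[xH /IH[c cxi]].
suff [i ix] : exists i : 'I_(H.*2), i%:R - H%:R <= x <= i%:R - H%:R + 1.
  by exists [tuple of i :: c]; rewrite /= ix.
move: xH; rewrite ler_norml => xH.
have [xlt|xge] := ltP x H%:R.
  have x0 : 0 <= x + H%:R by lra.
  have tx := truncn_itv x0.
  have tH : (Num.truncn (x + H%:R)%R < H.*2)%N.
    by rewrite -(ltr_nat R) -addnn natrD; lra.
  by exists (Ordinal tH) => /=; move: tx; rewrite -natr1; lra.
(* Only the endpoint [x = H] remains; it goes to the last cell. *)
have H2 : (H.*2.-1 < H.*2)%N by rewrite -addnn; lia.
exists (Ordinal H2) => /=.
have : (H.*2.-1.+1)%:R = H%:R + H%:R :> R by rewrite -natrD; congr _%:R; lia.
rewrite -natr1; lra.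
Qed.

Section Levels.
Variables (d : nat) (n : R) (h L : nat -> R).
Hypothesis n0 : 0 <= n.
Hypothesis h0 : forall i, 0 <= h i.
Hypothesis hS : {homo h : i j / (i <= j)%N >-> i <= j}.
Hypothesis L1 : forall i, 1 <= L i.
Hypothesis Lh : forall i, (d * (2 * d + 4))%:R * L i <= h i.

Definition above (j : nat) : set R := if j is j'.+1 then `]h j', +oo[ else setT.

Lemma measurable_above j : measurable (above j).
Proof. by case: j => [|j] /=; [exact: measurableT | exact: measurable_itv]. Qed.

(** Marks exceeding [h K] are all put into level [K], hence the alternative without an upper bound
    on [t]. *)
Lemma level_exists K t :
  exists j, [/\ (j <= K)%N, above j t & t <= h j \/ j = K].
Proof.
elim: K => [|K [j [jK tj tle]]]; first by exists 0%N; split => //; right.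
have [th|ht] := leP t (h j); first by exists j; split; [exact: leqW|by []|left].
case: tle => [|jE]; first by rewrite leNgt ht.
exists K.+1; split; [by []| |by right].
by rewrite /= in_itv/= andbT -jE.
Qed.

Variables (k H : nat).
Local Notation cell := (d.-tuple 'I_(H.*2)).

(* A point in the cell [c] whose mark is in [above j], respectively a point
   that is closer to the origin than the cell by a multiple of its own mark,
   which lies between [h j] and [h k.-1]. *)
Definition target (j : nat) (c : cell) (p : mpoint R) : R :=
  (inbox (map (@unit_itv R) (cell_corner c)) p.1)%:R * \1_(above j) p.2.

Definition blocker (j : nat) (c : cell) (p : mpoint R) : R :=
  \sum_(j <= i < k.-1) (inbox (map (inward (L i)) (cell_corner c)) p.1)%:R *
    \1_(`]h i, h i.+1]%classic) p.2.

Lemma target_ge0 j c p : 0 <= target j c p.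
Proof. by rewrite /target mulr_ge0. Qed.

(** The mark bands []h i, h i.+1]] are disjoint, so at most one summand is nonzero; the bound
    telescopes. *)
Lemma blocker_le1 j c p : 0 <= 1 - blocker j c p.
Proof.
rewrite subr_ge0 /blocker.
have [kj|jk] := leqP k.-1 j; first by rewrite big_geq.
apply: (@le_trans _ _ (\sum_(j <= i < k.-1)
    ((p.2 <= h i.+1)%R%:R - (p.2 <= h i)%R%:R : R))).
  apply: ler_sum => i _; rewrite indicE mem_setE in_itv/=.
  have hi : h i <= h i.+1 by exact: hS.
  case: (inbox _ _); rewrite ?mul1r ?mul0r; case: (leP p.2 (h i)) => /= p1;
    case: (leP p.2 (h i.+1)) => /= p2; rewrite ?subrr ?subr0 ?sub0r//; lra.
have /= -> := @telescope_sumr R j k.-1 (fun i => (p.2 <= h i)%R%:R) (ltnW jk).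
by case: (p.2 <= h k.-1); case: (p.2 <= h j); rewrite /=; lra.
Qed.

Lemma norm_coord_le (xi : seq R) x : x \in xi ->
  `|x| <= Num.sqrt (\sum_(y <- xi) y ^+ 2).
Proof.
move=> xin; rewrite -sqrtr_sqr ler_wsqrtr// (big_rem x)//= lerDl.
by rewrite sumr_ge0// => i _; exact: sqr_ge0.
Qed.

Lemma norm_le_coord (xi : seq R) (t : R) : 0 <= t ->
  all (fun x => `|x| <= t) xi ->
  Num.sqrt (\sum_(y <- xi) y ^+ 2) <= (size xi)%:R * t.
Proof.
move=> t0 xt; rewrite sqrt_le_abs ?mulr_ge0//.
apply: (@le_trans _ _ ((size xi)%:R * t ^+ 2)).
  elim: xi xt => [|x xi IH] /=; first by rewrite big_nil mul0r.
  move=> /andP[xt xit]; rewrite big_cons -natr1 mulrDl mul1r addrC lerD ?IH//.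
  by move: xt; rewrite ler_norml => xt; apply: sqr_le_sqr; lra.
rewrite exprMn ler_wpM2r ?sqr_ge0// -natrX ler_nat.
by case: (size xi) => // m; rewrite expnS expn1 leq_pmulr.
Qed.

Lemma edge_unblocked j c t s xi X r : in_torus d n xi ->
  all (fun p => in_torus d n p.1) X -> above k r -> above j s ->
  s <= h j \/ j = k -> (j <= k)%N ->
  inbox (map (@unit_itv R) (cell_corner c)) xi ->
  edge n ((origin R d, r) :: X) (origin R d, r) (xi, s) ->
  t \in X -> blocker j c t = 0.
Proof.
move=> xiT XT rk sj sjk jk cxi /and4P[/= xir s0 sr /norP[_ /hasPn nX]] tX.
rewrite /blocker big_nat big1// => i /andP[ji ik].
case: (boolP (inbox _ t.1)) => [ct|]; last by rewrite mul0r.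
rewrite indicE mem_setE in_itv/=; case: (boolP (_ && _)); last by rewrite mulr0.
move=> /andP[hit thi]; exfalso.
have k0 : k = k.-1.+1 by lia.
have kr : h k.-1 < r by move: rk; rewrite k0 /= in_itv/= andbT.
have tT : in_torus d n t.1 by exact: (allP XT).
have szc := size_cell_corner c.
have := nX _ tX; rewrite /inball => /negP; apply; apply/and4P; split.
- rewrite tdist_originl//; apply: inward_norm ct _ _; rewrite ?szc//.
  + exact: cell_corner_off_zero.
  + exact: cxi.
  + by rewrite (le_trans (Lh i))// ltW// (le_lt_trans _ kr)// hS// ltnW.
  + by rewrite -(tdist_originl xiT).
(* If [j = k], the mark [s] may exceed [h j], but then the range [j <= i < k.-1] is empty. *)
- case: sjk => [sh|jE]; last by move: ji ik; rewrite jE; lia.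
  by rewrite (le_lt_trans sh)// (le_lt_trans _ hit)// hS.
- by rewrite (le_lt_trans thi)// (le_lt_trans _ kr)// hS.
- apply: inward_tdist ct _ => //; rewrite ?szc//.
  + exact: cell_corner_off_zero.
  + by rewrite (le_trans (Lh i))// ltW.
Qed.

(** The alternative [n / 2 <= h k] serves the top level: there [r] is unbounded, but the coordinates
    in the torus are still at most [h k]. *)
Lemma Dout_le (alpha r : R) (X : seq (mpoint R)) : (0 < H)%N -> 0 <= alpha ->
  (forall x : R, `|x| <= h k -> `|x| <= n / 2 -> `|x| <= H%:R) ->
  all (fun p => in_torus d n p.1) X -> above k r -> r <= h k \/ n / 2 <= h k ->
  Dout d n alpha r X <= (d%:R * h k) `^ alpha *
    \sum_(i : 'I_k.+1 * cell) mecke_sum (target i.1 i.2)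
                                (fun p => 1 - blocker i.1 i.2 p) X.
Proof.
move=> H0 al0 hH XT rk rhk; rewrite /Dout.
set W := _ `^ alpha; have W0 : 0 <= W by exact: powR_ge0.
pose u (i : 'I_k.+1 * cell) : R := (all (fun x => 1 - blocker i.1 i.2 x == 1) X)%:R.
apply: (@le_trans _ _ (\sum_(p <- X) W * \sum_(i : 'I_k.+1 * cell)
    target i.1 i.2 p * u i)); last first.
  rewrite -mulr_sumr ler_wpM2l// exchange_big/=; apply: ler_sum => i _.
  rewrite -mulr_suml; apply: mecke_sum_ge => p; first exact: target_ge0.
  exact: blocker_le1.
rewrite big_seq [leRHS]big_seq; apply: ler_sum => -[xi s] pX /=.
have xiT : in_torus d n xi := allP XT _ pX.
have tu0 (i : 'I_k.+1 * cell) : 0 <= target i.1 i.2 (xi, s) * u i.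
  by rewrite mulr_ge0 ?target_ge0.
case: (boolP (edge _ _ _ _)) => [e|_]; last first.
  by rewrite mulr0 mulr_ge0// sumr_ge0.
have /and4P[/= xir _ _ _] := e; rewrite /inball tdist_originl// in xir.
have xin : all (fun x => `|x| <= n / 2) xi.
  have /andP[_ /allP D] := xiT; apply/allP => x /D; rewrite ler_norml; lra.
have xih : all (fun x => `|x| <= h k) xi.
  case: rhk => [rh|nh]; apply/allP => x xxi.
    by rewrite (le_trans (norm_coord_le xxi))// (le_trans xir).
  by rewrite (le_trans _ nh)// (allP xin).
have szxi : size xi = d by have /andP[/eqP] := xiT.
have [c cxi] : exists c : cell, inbox (map (@unit_itv R) (cell_corner c)) xi.
  apply: cell_cover => //; apply/allP => x xxi.
  by apply: hH; [exact: (allP xih)|exact: (allP xin)].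
have [j [jk sj sjk]] := level_exists k s.
have jk1 : (j < k.+1)%N by [].
rewrite mulr1 tdist_origin// -[leLHS]mulr1 ler_pM ?powR_ge0//.
  rewrite ge0_ler_powR// ?nnegrE ?sqrtr_ge0 ?mulr_ge0//.
  by rewrite -[in leRHS]szxi; exact: norm_le_coord.
rewrite (bigD1 (Ordinal jk1, c))//= (_ : target _ _ _ * _ = 1).
  by rewrite lerDl sumr_ge0.
rewrite /target cxi indicE mem_set// mulr1 mul1r /u /=.
suff -> : all (fun x => 1 - blocker j c x == 1) X by [].
by apply/allP => x xX; rewrite (edge_unblocked _ _ _ sj _ _ cxi e)// subr0.
Qed.

Lemma Dout_ge0 (m alpha r : R) (X : seq (mpoint R)) : 0 <= Dout d m alpha r X.
Proof. by rewrite /Dout sumr_ge0// => p _; rewrite mulr_ge0// powR_ge0. Qed.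

Section LevelBound.
Variable PR : probability R R.

Lemma ptI_target j (c : cell) : ptI d n PR (target j c)
  ((\prod_(ab <- map (@unit_itv R) (cell_corner c)) torus_len n ab) *
    fine (PR (above j))).
Proof.
apply: ptI_inbox; last exact: measurable_above.
by rewrite size_map size_cell_corner.
Qed.

Lemma ptI_unblocked j (c : cell) : ptI d n PR (fun p => 1 - blocker j c p)
  (n ^+ d - \sum_(j <= i < k.-1)
    (\prod_(ab <- map (inward (L i)) (cell_corner c)) torus_len n ab) *
    fine (PR `]h i, h i.+1]%classic)).
Proof.
have H1 i : ptI d n PR (fun p => (inbox (map (inward (L i)) (cell_corner c)) p.1)%:R *
    \1_(`]h i, h i.+1]%classic) p.2)
    ((\prod_(ab <- map (inward (L i)) (cell_corner c)) torus_len n ab) *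
    fine (PR `]h i, h i.+1]%classic)).
  by apply: ptI_inbox => //; rewrite size_map size_cell_corner.
have := ptI_lin 1 (-1) (ptI1 d PR n0) (ptI_sum (index_iota j k.-1) H1).
congr (ptI _ _ _ _ _); last by rewrite mul1r mulN1r.
by apply/funext => p; rewrite mul1r mulN1r.
Qed.

Lemma poisson_Dout_le (alpha r c1 : R) : (0 < H)%N -> 0 <= alpha ->
  (forall x : R, `|x| <= h k -> `|x| <= n / 2 -> `|x| <= H%:R) ->
  H%:R <= n / 2 + 1 -> (forall i, (i < k.-1)%N -> 2 * L i <= n / 2) ->
  (forall i, (i < k.-1)%N -> c1 <= L i ^+ d * fine (PR `]h i, h i.+1]%classic)) ->
  above k r -> r <= h k \/ n / 2 <= h k ->
  (poisson_expect d n PR (fun X => (Dout d n alpha r X)%:E) <=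
   ((d%:R * h k) `^ alpha * ((H.*2 ^ d)%:R * \sum_(j < k.+1)
      fine (PR (above j)) * expR (- (c1 * (k.-1 - j)%N%:R))))%:E)%E.
Proof.
move=> H0 al0 hH Hn Ln hc rk rhk.
apply: le_trans (poisson_expect_le (fun X => Dout_ge0 _ _ _ _) (powR_ge0 _ _)
  (fun X XT => Dout_le H0 al0 hH XT rk rhk) _ _ (fun i => ptI_target i.1 i.2)
  (fun i => ptI_unblocked i.1 i.2)) _.
- move=> i; apply: ptI_ge0 (ptI_target i.1 i.2); exact: target_ge0.
- move=> i; apply: ptI_ge0 (ptI_unblocked i.1 i.2); exact: blocker_le1.
rewrite lee_fin ler_wpM2l ?powR_ge0// mulr_sumr.
pose B (j : 'I_k.+1) (c : cell) : R :=
  fine (PR (above j)) * expR (- (c1 * (k.-1 - j)%N%:R)).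
apply: (@le_trans _ _ (\sum_(i : 'I_k.+1 * cell) B i.1 i.2)); last first.
  rewrite -(pair_bigA _ B) /=; apply: ler_sum => j _.
  by rewrite /B sumr_const card_tuple card_ord mulr_natl.
apply: ler_sum => -[j c] _ /=; rewrite /B.
apply: ler_pM; rewrite ?expR_ge0 ?mulr_ge0 ?fine_ge0 ?prodr_ge0//.
- by move=> ab _; exact: torus_len_ge0.
- rewrite ler_piMl ?fine_ge0// big_map; apply: prodr_ile1 => m _.
  rewrite torus_len_ge0/= (le_trans (torus_len_le _ _))//= ?lerDl//.
  by rewrite addrAC subrr add0r.
rewrite ler_expR addrAC subrr add0r lerN2.
have -> : (k.-1 - j)%N%:R = \sum_(j <= i < k.-1) (1 : R).
  by rewrite sumr_const_nat.
rewrite mulr_sumr [leLHS]big_nat [leRHS]big_nat; apply: ler_sum => i /andP[_ ik].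
rewrite mulr1; apply: le_trans (hc i ik) _.
rewrite ler_wpM2r ?fine_ge0// big_map big_seq.
have -> : \prod_(m <- cell_corner c | m \in cell_corner c) torus_len n (inward (L i) m)
        = \prod_(m <- cell_corner c) L i.
  rewrite [RHS]big_seq; apply: eq_bigr => m mc.
  have om : off_zero m by exact: (allP (cell_corner_off_zero c)).
  have mb := cell_corner_bounds mc.
  have [|e1 e2 e3 e4] := inward_itv om (L1 i) (Ln i ik); first lra.
  by rewrite torus_lenE.
by rewrite big_const_seq count_predT size_cell_corner iter_mulr_1.
Qed.

End LevelBound.
End Levels.
End Covering.

(** * Tails and dyadic sums *)

Section Summation.
Variable R : realType.

Lemma has_integral_sum_indic dsp (T : measurableType dsp)
    (mu : {measure set T -> \bar R}) (r : seq nat) (A : nat -> set T) (e : nat -> R) :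
  (mu setT < +oo)%E -> (forall k, measurable (A k)) ->
  has_integral mu setT (fun x => \sum_(k <- r) e k * \1_(A k) x)
    (\sum_(k <- r) e k * fine (mu (A k))).
Proof.
move=> Too mA; elim: r => [|k r IH].
  rewrite big_nil; apply: has_integral_ext (has_integral0 mu measurableT) => x.
  by rewrite big_nil.
have H := has_integral_indic measurableT (mA k) Too.
have := has_integral_lin (e k) 1 measurableT H IH.
rewrite setIT mul1r big_cons; apply: has_integral_ext => x.
by rewrite big_cons mul1r.
Qed.

Lemma geometric_sum_le (q : R) K : 0 <= q -> q < 1 ->
  \sum_(0 <= k < K) q ^+ k <= (1 - q)^-1.
Proof.
move=> q0 q1; have q1' : 0 < 1 - q by lra.
rewrite -[leRHS]mul1r ler_pdivlMr//.
suff -> : (\sum_(0 <= k < K) q ^+ k) * (1 - q) = 1 - q ^+ K.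
  by rewrite lerBlDr lerDl exprn_ge0.
elim: K => [|K IH]; first by rewrite big_geq// mul0r expr0 subrr.
by rewrite big_nat_recr//= mulrDl IH exprS; ring.
Qed.

Lemma geometric_sum_le_gt1 (q : R) K : 1 < q ->
  \sum_(0 <= k < K) q ^+ k <= q ^+ K / (q - 1).
Proof.
move=> q1; have q1' : 0 < q - 1 by lra.
rewrite ler_pdivlMr//.
suff -> : (\sum_(0 <= k < K) q ^+ k) * (q - 1) = q ^+ K - 1 by lra.
elim: K => [|K IH]; first by rewrite big_geq// mul0r expr0 subrr.
by rewrite big_nat_recr//= mulrDl IH exprS; ring.
Qed.

(* The sum over mark levels [j]: the tail [p j] decays faster than the avoidance
   probabilities [q ^+ (k - 1 - j)] grow, so level [0] dominates. *)
Lemma level_sum_le (p : nat -> R) (Ct a q : R) k : 0 <= Ct -> 0 <= a -> a <= 4^-1 ->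
  2^-1 <= q -> q < 1 -> (forall j, 0 <= p j) -> (forall j, p j <= Ct * a ^+ j) ->
  \sum_(j < k.+1) p j * q ^+ (k.-1 - j) <= 4 * Ct * q ^+ k.
Proof.
move=> Ct0 a0 a4 q2 q1 p0 pa; have q0 : 0 < q by lra.
apply: (@le_trans _ _ (\sum_(j < k.+1) (2 * Ct * q ^+ k) * 2^-1 ^+ j)).
  apply: ler_sum => j _.
  (* Using [j.+1] absorbs the truncated subtraction: the exponents add up to at least [k] even if
     [k = 0] or [j = k]. This costs a factor 2. *)
  have H : q ^+ (k.-1 - j) * q ^+ j.+1 <= q ^+ k.
    rewrite -exprD ler_wiXn2l//; [exact: ltW|exact: ltW|].
    by have := ltn_ord j; lia.
  have q2j : 2^-1 ^+ j.+1 <= q ^+ j.+1 by rewrite lerXn2r ?nnegrE//; lra.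
  have h2 : 0 < 2^-1 ^+ j.+1 :> R by rewrite exprn_gt0.
  have H2 : q ^+ (k.-1 - j) * 2^-1 ^+ j.+1 <= q ^+ k.
    by apply: le_trans H; rewrite ler_wpM2l// exprn_ge0// ltW.
  have aj : a ^+ j <= 2^-1 ^+ j * 2^-1 ^+ j.
    by rewrite -exprMn lerXn2r ?nnegrE//; lra.
  apply: (@le_trans _ _ (Ct * a ^+ j * q ^+ (k.-1 - j))).
    by rewrite ler_wpM2r// exprn_ge0// ltW.
  apply: (@le_trans _ _ (Ct * (2^-1 ^+ j * 2^-1 ^+ j) * q ^+ (k.-1 - j))).
    by rewrite ler_wpM2r ?exprn_ge0 ?ler_wpM2l// ltW.
  have -> : Ct * (2^-1 ^+ j * 2^-1 ^+ j) * q ^+ (k.-1 - j) =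
      (2 * Ct * 2^-1 ^+ j) * (q ^+ (k.-1 - j) * 2^-1 ^+ j.+1).
    by rewrite [_ ^+ j.+1]exprS; field.
  have -> : 2 * Ct * q ^+ k * 2^-1 ^+ j = (2 * Ct * 2^-1 ^+ j) * q ^+ k by ring.
  by rewrite ler_wpM2l// !mulr_ge0// exprn_ge0.
rewrite -mulr_sumr -(big_mkord xpredT (fun j => 2^-1 ^+ j)).
have := @geometric_sum_le 2^-1 k.+1; rewrite (_ : (1 - 2^-1)^-1 = 2 :> R); last by field.
move=> /(_ _ _)/wrap[||S]; [lra|lra|].
have c0 : 0 <= 2 * Ct * q ^+ k by rewrite !mulr_ge0// exprn_ge0// ltW.
by apply: le_trans (ler_wpM2l c0 S) _; lra.
Qed.

End Summation.

Section Tail.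
Variables (R : realType) (d : nat) (PR : probability R R) (beta : R).
Hypothesis d2 : (2 <= d)%N.
Hypothesis beta0 : 0 < beta.
Hypothesis tail :
  (fun h : R => ((h ^+ d)%:E * PR `]h, +oo[%classic)%E) @ +oo --> beta%:E.

(** Doubling [t] divides the tail by about [2 ^+ d >= 4], so the band between [t] and [2 * t] keeps
    a fixed share of it. *)
Lemma tail_bounds (m : nat) : exists h0 : nat, [/\ (m <= h0)%N, (0 < h0)%N &
  forall t : R, h0%:R <= t ->
    t ^+ d * fine (PR `]t, +oo[%classic) <= 2 * beta /\
    beta / 2 <= t ^+ d * fine (PR `]t, 2 * t]%classic)].
Proof.
have [_ /cvgrPdist_lt tl] := (fine_cvgP _ _).1 tail.
(* Precision [beta / 8] suffices: the band keeps at least [7/8 - 9/32 = 19/32] of [beta]. *)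
have b0 := beta0; have b8 : 0 < beta / 8 by rewrite divr_gt0.
have [M [_ HM]] := tl _ b8.
exists (maxn m (Num.truncn `|M|).+1); split; [exact: leq_maxl| |].
  by rewrite leq_max orbT.
move=> t ht.
have Mt : M < t.
  apply: lt_le_trans ht; apply: le_lt_trans (ler_norm M) _.
  apply: lt_le_trans (truncnS_gt _) _; rewrite ler_nat; exact: leq_maxr.
have t1 : 1 <= t.
  by apply: le_trans ht; rewrite ler1n leq_max orbT.
have H s : M < s -> `|beta - s ^+ d * fine (PR `]s, +oo[%classic)| < beta / 8.
  by move=> /HM /=; rewrite fineM// fin_num_measure.
have := H t Mt; have := H (2 * t).
rewrite !ltr_norml => /(_ _)/wrap[|H2 H1]; first lra.
split; first lra.
have m1 : measurable (`]t, 2 * t] : set R) by [].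
have m2 : measurable (`]2 * t, +oo[ : set R) by [].
have E : fine (PR `]t, +oo[%classic) =
    fine (PR `]t, 2 * t]%classic) + fine (PR `](2 * t), +oo[%classic).
  rewrite -fineD ?fin_num_measure// -measureU//.
    congr (fine (PR _)); apply/seteqP; split => x /=; rewrite !in_itv/= ?andbT.
      by case: (leP x (2 * t)) => ? ?; [left; apply/andP|right].
    by case=> [/andP[]//|]; apply: lt_trans; lra.
  apply/seteqP; split => x //=; rewrite !in_itv/= andbT => -[/andP[_ a] b].
  by have := le_lt_trans a b; rewrite ltxx.
have td : 0 <= t ^+ d * fine (PR `](2 * t), +oo[%classic).
  by rewrite mulr_ge0 ?fine_ge0 ?exprn_ge0//; lra.
have E4 : 4 <= 2 ^+ d :> R.
  by rewrite (_ : 4 = 2 ^+ 2) ?ler_eXn2l ?ltr1n//; ring.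
move: H2; rewrite exprMn -mulrA => H2.
have := ler_wpM2r td E4 => H3.
have : t ^+ d * fine (PR `]t, +oo[%classic) = t ^+ d * fine (PR `]t, 2 * t]%classic) +
  t ^+ d * fine (PR `](2 * t), +oo[%classic) by rewrite E mulrDr.
lra.
Qed.

End Tail.

(** * Bounds at a fixed scale *)

Section Main.
Variables (R : realType) (d : nat) (PR : probability R R) (beta : R).
Hypothesis d2 : (2 <= d)%N.
Hypothesis beta0 : 0 < beta.

Section Scales.
Variable h0 : nat.
Hypothesis h0d : (d * (2 * d + 4) <= h0)%N.
Hypothesis tails : forall t : R, h0%:R <= t ->
    t ^+ d * fine (PR `]t, +oo[%classic) <= 2 * beta /\
    beta / 2 <= t ^+ d * fine (PR `]t, 2 * t]%classic).

(** This is the constant of [inward_norm] and [inward_tdist]; [h0 >= cd] makes every [L i] at least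
    1. *)
Let cd : nat := (d * (2 * d + 4))%N.
Let hN (i : nat) : nat := (h0 * 2 ^ i)%N.
Let h (i : nat) : R := (hN i)%:R.
Let L (i : nat) : R := h i / cd%:R.

Let cd16 : (16 <= cd)%N.
Proof. by rewrite /cd; move: d2; nia. Qed.

Let cd0 : 0 < cd%:R :> R.
Proof. by rewrite ltr0n; apply: leq_trans cd16. Qed.

Let h0_gt0 : (0 < h0)%N.
Proof. by apply: leq_trans h0d; apply: leq_trans cd16. Qed.

Let hN_h0 i : (h0 <= hN i)%N.
Proof. by rewrite /hN leq_pmulr// expn_gt0. Qed.

Let hS : {homo h : i j / (i <= j)%N >-> i <= j}.
Proof. by move=> i j ij; rewrite /h ler_nat /hN leq_mul2l leq_exp2l// ij orbT. Qed.

Let hSE i : h i.+1 = 2 * h i.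
Proof. by rewrite /h /hN expnS mulnCA natrM. Qed.

Let hE i : h i = h0%:R * 2 ^+ i.
Proof. by rewrite /h /hN natrM natrX. Qed.

Let L_ge1 i : 1 <= L i.
Proof.
by rewrite /L ler_pdivlMr// mul1r /h ler_nat (leq_trans h0d).
Qed.

Let LE i : cd%:R * L i = h i.
Proof. by rewrite /L mulrC divfK// gt_eqF. Qed.

(** The 1 bounds level 0. The factor [2 ^+ d] pays for an index shift, as [above h j.+1] starts at
    [h j]. *)
Definition tail_const : R := 1 + 2 * beta * 2 ^+ d.

Let tail_above j : fine (PR (above h j)) <= tail_const * (2 ^+ d)^-1 ^+ j.
Proof.
have b0 := beta0.
have p2 : 0 < 2 ^+ d :> R by rewrite exprn_gt0.
have bp : 0 <= beta * 2 ^+ d by rewrite mulr_ge0// ltW.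
case: j => [|j] /=.
  rewrite expr0 mulr1 /tail_const (@le_trans _ _ 1)//; last by lra.
  by rewrite -lee_fin fineK ?fin_num_measure// probability_le1.
have hj : h0%:R <= h j by rewrite /h ler_nat.
have [Hj _] := tails hj.
have hp : 1 <= h0%:R :> R by rewrite ler1n.
have hjd : (2 ^+ d) ^+ j <= h j ^+ d.
  by rewrite hE exprMn exprAC ler_peMl ?exprn_ge0// exprn_ege1.
rewrite exprVn -[leRHS]mul1r mulrA ler_pdivlMr ?exprn_gt0// mul1r.
rewrite exprS; set P := fine _ in Hj *.
have P0 : 0 <= P by exact: fine_ge0.
have H1 : P * (2 ^+ d) ^+ j <= 2 * beta.
  by apply: le_trans Hj; rewrite mulrC ler_wpM2r.
have := ler_wpM2l (ltW p2) H1.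
rewrite /tail_const => H2; rewrite mulrCA; lra.
Qed.

Let block_mass : R := beta / 2 / cd%:R ^+ d.

Let block_mass_le i : block_mass <= L i ^+ d * fine (PR `]h i, h i.+1]%classic).
Proof.
have hi : h0%:R <= h i by rewrite /h ler_nat.
have [_ H] := tails hi.
by rewrite /block_mass /L hSE exprMn exprVn [leRHS]mulrAC ler_wpM2r// invr_ge0 exprn_ge0.
Qed.

(** Per level, the weight grows by [2 ^ alpha], the number of cells by at most [2 ^ d], and avoiding
    the blockers gains a factor [q]. *)
Lemma poisson_scale_le (alpha q r : R) (n K k : nat) : 0 <= alpha ->
  2^-1 <= q -> q < 1 -> expR (- block_mass) <= q ->
  (hN K.-1 <= n)%N -> (n <= hN K)%N -> (0 < K)%N -> (k <= K)%N ->
  above h k r -> r <= h k \/ k = K ->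
  (poisson_expect d n%:R PR (fun X => (Dout d n%:R alpha r X)%:E) <=
    ((d * h0)%:R `^ alpha * (2 * h0%:R) ^+ d * (4 * tail_const) *
     (2 `^ alpha * 2 ^+ d * q) ^+ k)%:E)%E.
Proof.
move=> al0 q2 q1 bq nK1 nK K0 kK rk rhk; have b0 := beta0.
(* The cap keeps the cells within one unit of the fundamental box. *)
pose H := minn (hN k) (n./2.+1).
have n2 : (n./2)%:R <= n%:R / 2 :> R.
  rewrite ler_pdivlMr// -natrM ler_nat muln2.
  by rewrite -[leqRHS]odd_double_half leq_addl.
have n2' : n%:R / 2 <= (n./2.+1)%:R :> R.
  rewrite ler_pdivrMr// -natrM ler_nat muln2 doubleS -[leqLHS]odd_double_half.
  by case: (odd n); rewrite ?add1n ?add0n; lia.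
have Ln i : (i < k.-1)%N -> 2 * L i <= n%:R / 2.
  move=> ik; have : h i <= n%:R.
    apply: (@le_trans _ _ (h K.-1)); first by apply: hS; lia.
    by rewrite /h ler_nat.
  have : 16 * L i <= h i by rewrite -LE ler_wpM2r ?ler_nat// (le_trans _ (L_ge1 i)).
  by have := L_ge1 i; lra.
have H0 : (0 < H)%N by rewrite /H leq_min (leq_trans h0_gt0).
have rhk' : r <= h k \/ n%:R / 2 <= h k.
  case: rhk => [|->]; [by left|right]; have : n%:R <= h K by rewrite /h ler_nat.
  by have : 0 <= n%:R :> R by []; lra.
have hH (x : R) : `|x| <= h k -> `|x| <= n%:R / 2 -> `|x| <= H%:R.
  move=> xh xn; rewrite /H; case: leqP => _ //; exact: le_trans n2'.
have Hn : H%:R <= n%:R / 2 + 1 :> R.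
  apply: (@le_trans _ _ (n./2.+1)%:R); first by rewrite ler_nat geq_minr.
  by rewrite -natr1; lra.
have Lh i : cd%:R * L i <= h i by rewrite LE.
have := @poisson_Dout_le R d n%:R h L (ler0n _ _) (fun i => ler0n _ _) hS L_ge1
  Lh k H PR alpha r block_mass H0 al0 hH Hn Ln
  (fun i _ => block_mass_le i) rk rhk'.
move=> /le_trans; apply; rewrite lee_fin.
have q0 : 0 < q by lra.
have p2 : 0 < 2 ^+ d :> R by rewrite exprn_gt0.
have tc0 : 0 <= tail_const by rewrite /tail_const addr_ge0// !mulr_ge0// ltW.
have S : \sum_(j < k.+1) fine (PR (above h j)) *
     expR (- (block_mass * (k.-1 - j)%N%:R)) <= 4 * tail_const * q ^+ k.
  apply: le_trans (level_sum_le k tc0 _ _ q2 q1 _ tail_above).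
  - apply: ler_sum => j _; rewrite ler_wpM2l ?fine_ge0//.
    rewrite -mulNr mulrC expRM_natl lerXn2r ?nnegrE ?expR_ge0//; exact: ltW.
  - by rewrite invr_ge0 ltW.
  - rewrite lef_pV2 ?posrE//.
    by rewrite (_ : 4 = 2 ^+ 2) ?ler_eXn2l ?ltr1n//; ring.
  - by move=> j; exact: fine_ge0.
have HW : (H.*2 ^ d)%:R <= (2 * h0%:R) ^+ d * (2 ^+ d) ^+ k :> R.
  rewrite natrX exprAC -exprMn -mulrA -hE.
  rewrite lerXn2r ?nnegrE//; first by rewrite mulr_ge0.
  by rewrite -mul2n natrM ler_wpM2l// /h ler_nat geq_minl.
have W : (d%:R * h k) `^ alpha = (d * h0)%:R `^ alpha * (2 `^ alpha) ^+ k.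
  rewrite hE mulrA -natrM powRM ?exprn_ge0//; congr (_ * _).
  by rewrite -powR_mulrn// -powRrM mulrC powRrM powR_mulrn// powR_ge0.
rewrite W.
have -> : (d * h0)%:R `^ alpha * (2 * h0%:R) ^+ d * (4 * tail_const) *
     (2 `^ alpha * 2 ^+ d * q) ^+ k =
  (d * h0)%:R `^ alpha * (2 `^ alpha) ^+ k *
   ((2 * h0%:R) ^+ d * (2 ^+ d) ^+ k * (4 * tail_const * q ^+ k)).
  move: (_ `^ alpha) (2 `^ alpha) (2 ^+ d) ((2 * _) ^+ d) (4 * _) => x y z u v.
  by rewrite !exprMn; move: (y ^+ k) (z ^+ k) (q ^+ k) => *; ring.
apply: ler_wpM2l; first by rewrite mulr_ge0 ?exprn_ge0 ?powR_ge0.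
apply: ler_pM => //; apply: sumr_ge0 => j _.
by rewrite mulr_ge0 ?expR_ge0 ?fine_ge0.
Qed.

(** Here [s = d] is critical: the tail of order [2 ^ (- d k)] of the mark at the origin exactly
    cancels the growth [2 ^ (d k)] of the number of cells. *)
Lemma EDout_scale_le (alpha q : R) (n K : nat) : 0 <= alpha ->
  2^-1 <= q -> q < 1 -> expR (- block_mass) <= q ->
  (hN K.-1 <= n)%N -> (n <= hN K)%N -> (0 < K)%N ->
  (EDout d n PR alpha <=
    ((d * h0)%:R `^ alpha * (2 * h0%:R) ^+ d * (4 * tail_const) * tail_const *
     \sum_(0 <= k < K.+1) (2 `^ alpha * q) ^+ k)%:E)%E.
Proof.
move=> al0 q2 q1 bq nK1 nK K0; have b0 := beta0; rewrite /EDout.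
set W := _ * _ * (4 * tail_const).
have p2 : 0 < 2 ^+ d :> R by rewrite exprn_gt0.
have tc0 : 0 <= tail_const by rewrite /tail_const addr_ge0// !mulr_ge0// ltW.
have W0 : 0 <= W by rewrite !mulr_ge0 ?powR_ge0 ?exprn_ge0.
pose e k := W * (2 `^ alpha * 2 ^+ d * q) ^+ k.
have q0 : 0 <= q by lra.
have e0 k : 0 <= e k by rewrite /e !mulr_ge0// exprn_ge0// !mulr_ge0// ?powR_ge0 ?exprn_ge0.
have PT : (PR setT < +oo)%E.
  exact: le_lt_trans (probability_le1 PR measurableT) (ltry _).
have [_ I] := has_integral_sum_indic (index_iota 0 K.+1) e PT (@measurable_above R h).
(* The integrand is dominated by a step function of the mark: the term of the level of [r] suffices,
   and the others are nonnegative. *)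
apply: (@le_trans _ _ (\sum_(0 <= k < K.+1) e k * fine (PR (above h k)))%:E).
  rewrite -I; apply: ge0_le_integral_nomeas => r _.
    apply: nneseries_ge0 => k _ _; rewrite mule_ge0//.
    by apply: cfgint_ge0 => s; rewrite lee_fin Dout_ge0.
  have [k [kK rk rhk]] := level_exists h K r.
  apply: le_trans (poisson_scale_le al0 q2 q1 bq nK1 nK K0 kK rk rhk) _.
  rewrite lee_fin big_mkord (bigD1 (Ordinal (kK : (k < K.+1)%N)))//=.
  rewrite indicE mem_set// mulr1 -/W -/(e k) lerDl.
  by rewrite sumr_ge0// => j _; rewrite mulr_ge0.
rewrite lee_fin mulr_sumr; apply: ler_sum => k _.
have -> : W * tail_const * (2 `^ alpha * q) ^+ k =
    e k * (tail_const * (2 ^+ d)^-1 ^+ k).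
  have pk : (2 ^+ d) ^+ k != 0 :> R by rewrite expf_neq0// gt_eqF.
  rewrite /e exprVn !exprMn; field; rewrite ?pk//.
by rewrite ler_wpM2l.
Qed.

End Scales.

End Main.

(** * Choice of the scale and of the exponent *)

Lemma dyadic_scale (h0 n : nat) : (0 < h0)%N -> (h0 <= n)%N ->
  exists K, [/\ (0 < K)%N, (h0 * 2 ^ K.-1 <= n)%N & (n <= h0 * 2 ^ K)%N].
Proof.
move=> h00 h0n; exists (trunc_log 2 (n %/ h0)).+1.
have nh : (0 < n %/ h0)%N by rewrite divn_gt0.
have /andP[l u] := trunc_log_bounds (isT : (1 < 2)%N) nh; split => //=.
  by rewrite mulnC -leq_divRL.
by rewrite mulnC ltnW// -ltn_divLR.
Qed.

(** Taking [q] as a power of 2 turns the ratio [2 ^ alpha * q] into [2 ^ (alpha - delta)];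
    [delta <= c] suffices because [ln 2 <= 1]. *)
Lemma avoidance_rate (R : realType) (c delta : R) :
  0 < delta -> delta <= 1 -> delta <= c ->
  [/\ 2^-1 <= 2 `^ (- delta), 2 `^ (- delta) < 1 & expR (- c) <= 2 `^ (- delta)].
Proof.
move=> d0 d1 dc.
have ln2 : 0 < ln 2 :> R by rewrite ln_gt0// ltr1n.
have ln21 : ln 2 <= 1 :> R by have := @le_ln1Dx R 1; rewrite (_ : 1 + 1 = 2)//; apply.
have E : 2 `^ (- delta) = expR (- delta * ln 2) by rewrite /powR pnatr_eq0.
split.
- by rewrite -powR_inv1// ler_powR ?lerN2// ler1n.
- by rewrite E expR_lt1 mulNr oppr_lt0 mulr_gt0.
- by rewrite E ler_expR; nra.
Qed.

Theorem theorem2p7 (R : realType) (d : nat) (PR : probability R R) (beta : R) :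
  (2 <= d)%N ->
  (* R has an absolutely continuous distribution *)
  PR `<< (@lebesgue_measure R) ->
  (* R is nonnegative *)
  PR `[0, +oo[%classic = 1%E ->
  (* tail assumption with s = d *)
  0 < beta ->
  (fun h : R => ((h ^+ d)%:E * PR `]h, +oo[%classic)%E) @ +oo --> beta%:E ->
  (exists C : R, exists N : nat, forall n : nat, (N <= n)%N ->
      (EDout d n PR 0 <= C%:E)%E) /\
  (forall alpha : R, 0 < alpha ->
     exists delta : R, 0 < delta /\
     exists C : R, exists N : nat, forall n : nat, (N <= n)%N ->
       (EDout d n PR alpha <= (C * (n%:R `^ (alpha - delta)))%:E)%E).
Proof.
move=> d2 _ _ b0 tail.
have [h0 [h0d h00 tails]] := tail_bounds d2 b0 tail (d * (2 * d + 4)).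
pose c : R := beta / 2 / (d * (2 * d + 4))%:R ^+ d.
have c0 : 0 < c by rewrite !divr_gt0// exprn_gt0// ltr0n; nia.
pose W (alpha : R) : R := (d * h0)%:R `^ alpha * (2 * h0%:R) ^+ d *
  (4 * tail_const d beta) * tail_const d beta.
have W0 alpha : 0 <= W alpha.
  have tc : 0 <= tail_const d beta by rewrite addr_ge0// !mulr_ge0// ltW.
  by rewrite !mulr_ge0 ?powR_ge0 ?exprn_ge0.
have bound (alpha delta : R) (n : nat) : 0 <= alpha -> 0 < delta ->
    delta <= Num.min 1 c -> (h0 <= n)%N -> exists K,
    [/\ (0 < K)%N, (2 ^ K.-1 <= n)%N & (EDout d n PR alpha <=
      (W alpha * \sum_(0 <= k < K.+1) (2 `^ alpha * 2 `^ (- delta)) ^+ k)%:E)%E].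
  move=> al0 de0; rewrite le_min => /andP[de1 dec] h0n.
  have [q2 q1 cq] := avoidance_rate de0 de1 dec.
  have [K [K0 lK uK]] := dyadic_scale h00 h0n; exists K; split => //.
    by apply: leq_trans lK; rewrite leq_pmull.
  exact: (EDout_scale_le d2 b0 h0d tails al0 q2 q1 cq lK uK K0).
have m0 : 0 < Num.min 1 c by rewrite lt_min c0 ltr01.
split.
  have m1 : Num.min 1 c <= 1 by rewrite ge_min lexx.
  have mc : Num.min 1 c <= c by rewrite ge_min lexx orbT.
  have [q2 q1 _] := avoidance_rate m0 m1 mc.
  (* For [alpha = 0] the ratio is below 1, and the full geometric series bounds the sum uniformly in
     [K]. *)
  exists (W 0 * (1 - 2 `^ (- Num.min 1 c))^-1), h0 => n h0n.
  have [K [K0 _ H]] := bound 0 _ n (lexx 0) m0 (lexx _) h0n.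
  apply: le_trans H _; rewrite lee_fin ler_wpM2l// powRr0 mul1r.
  by apply: geometric_sum_le => //; lra.
(* Capping [delta] at [alpha / 2] keeps the ratio [theta] above 1, so the last term controls the
   sum. *)
move=> alpha al0; pose delta := Num.min (alpha / 2) (Num.min 1 c).
have de0 : 0 < delta by rewrite lt_min m0 andbT divr_gt0.
have dea : delta <= alpha / 2 by rewrite ge_min lexx.
have dem : delta <= Num.min 1 c by rewrite ge_min lexx orbT.
exists delta; split => //.
pose theta : R := 2 `^ (alpha - delta).
have t1 : 1 < theta.
  rewrite /theta /powR pnatr_eq0 expR_gt1 mulr_gt0 ?ln_gt0 ?ltr1n//.
  by rewrite subr_gt0; lra.
(* Only [2 ^ K.-1] is known to be at most [n], so [theta ^+ 2] is split off from [theta ^+ K.+1]. *)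
exists (W alpha * (theta ^+ 2 / (theta - 1))), h0 => n h0n.
have [K [K0 Kn H]] := bound _ _ _ (ltW al0) de0 dem h0n.
apply: le_trans H _; rewrite lee_fin -mulrA ler_wpM2l//.
have -> : 2 `^ alpha * 2 `^ (- delta) = theta.
  by rewrite /theta powRD// pnatr_eq0 implybT.
apply: le_trans (geometric_sum_le_gt1 _ t1) _.
have -> : theta ^+ K.+1 / (theta - 1) = theta ^+ 2 / (theta - 1) * theta ^+ K.-1.
  by rewrite mulrAC -exprD; congr (_ ^+ _ / _); lia.
rewrite ler_wpM2l//; first by rewrite divr_ge0 ?exprn_ge0//; lra.
rewrite /theta -powR_mulrn ?powR_ge0// powRAC powR_mulrn//.
rewrite ge0_ler_powR ?nnegrE ?exprn_ge0//; first by lra.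
by rewrite -natrX ler_nat.
Qed.
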